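(* Let $\mathbb{F}\subset\mathbb{C}$ be a field and let $p_1,p_2,q_1,q_2$ be positive integers with $p_1<p_2$, $p_1+q_1=p_2+q_2=N$, $p_1\neq q_2$ and $p_2\neq q_1$. Suppose that $f_1,f_2,g_1,g_2\colon\mathbb{F}\to\mathbb{C}$ are higher order derivations (a linear term being allowed; see the context), none of them identically zero, that satisfy \[ f_1(x^{p_1})g_1(x)^{q_1}+f_2(x^{p_2})g_2(x)^{q_2}=0\qquad(x\in\mathbb{F}). \] Then all of them (as higher order derivations) are of order at most $1$, and the solutions are one of the following, where $d\colon\mathbb{F}\to\mathbb{C}$ is a derivation and all identities hold for every $x\in\mathbb{F}$. (A) \[ f_1(x)=\lambda_{1,1}d(x)+\lambda_{1,0}x,\quad f_2(x)=\lambda_{2,0}x,\quad g_1(x)=\mu_{1,1}d(x)+\mu_{1,0}x,\quad g_2(x)=\mu_{2,1}d(x)+\mu_{2,0}x, \] where $\lambda_{1,1},\lambda_{2,0},\mu_{1,1},\mu_{2,1}\in\mathbb{C}$ are nonzero, $q_2=q_1+1$ (i.e. $p_2=p_1-1$), and \[ p_1\cdot\lambda_{1,1}\cdot(\mu_{1,1})^{q_1}+\lambda_{2,0}\cdot(\mu_{2,1})^{q_1+1}=0 . \] Equivalently, there is a function $h(x)=d(x)+ax$ (with $a\in\mathbb{C}$) such that \[ f_1(x^{p_1})=\lambda_{1,1}p_1h(x)x^{p_1-1},\quad g_1(x)=\mu_{1,1}h(x)\quad\text{and}\quad g_2(x)=\mu_{2,1}h(x). \] (B) \[ f_1(x)=\lambda_{1,1}d(x)+\lambda_{1,0}x,\quad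 f_2(x)=\lambda_{2,0}x,\quad g_1(x)=\mu_{1,0}x,\quad g_2(x)=\mu_{2,1}d(x)+\mu_{2,0}x, \] where $\lambda_{1,1},\lambda_{2,0},\mu_{1,0},\mu_{2,1}\in\mathbb{C}$ are nonzero, $q_2=1$ (i.e. $p_2=N-1$), and \[ p_1\cdot\lambda_{1,1}\cdot(\mu_{1,0})^{q_1}+\lambda_{2,0}\cdot\mu_{2,1}=0 . \] Furthermore, $f_1(x^{p_1})=c_1g_2(x)x^{p_1-1}$ and $g_1(x)=c_2f_2(x)$, where $c_1\cdot c_2=-\lambda_{2,0}^{1-q_1}$. (C) \[ f_1(x)=\lambda_{1,1}d(x)+\lambda_{1,0}x,\quad f_2(x)=\lambda_{2,1}d(x)+\lambda_{2,0}x,\quad g_1(x)=\mu_{1,0}x,\quad g_2(x)=\mu_{2,0}x, \] where $\lambda_{i,j},\mu_{i,0}\in\mathbb{C}$ for all $i\in\{1,2\}$, $j\in\{0,1\}$, satisfy \[ p_1\cdot\lambda_{1,1}\cdot(\mu_{1,0})^{q_1}+p_2\cdot\lambda_{2,1}\cdot(\mu_{2,0})^{q_2}=0 \quad\text{and}\quad \lambda_{1,0}\cdot(\mu_{1,0})^{q_1}+\lambda_{2,0}\cdot(\mu_{2,0})^{q_2}=0 . \] In particular, $x^{p_2-p_1}f_1(x^{p_1})=c\,f_2(x^{p_2})$ for some $c\in\mathbb{C}$. (This case includes those in which all solutions are linear functions.)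
   Context: A function $f\colon\mathbb{F}\to\mathbb{C}$ is additive if $f(x+y)=f(x)+f(y)$ for all $x,y\in\mathbb{F}$. An additive $d\colon\mathbb{F}\to\mathbb{C}$ is a derivation if $d(xy)=d(x)y+xd(y)$ for all $x,y\in\mathbb{F}$. Let $\mathscr{D}_0(\mathbb{F})=\{0\}$; for $k\ge1$, $\mathscr{D}_k(\mathbb{F})$, the set of derivations of order $k$, consists of the additive functions $f\colon\mathbb{F}\to\mathbb{C}$ for which there is $B\colon\mathbb{F}\times\mathbb{F}\to\mathbb{C}$ that belongs to $\mathscr{D}_{k-1}(\mathbb{F})$ in each variable and satisfies $f(xy)-xf(y)-f(x)y=B(x,y)$ for all $x,y\in\mathbb{F}$. In the statement, ''higher order derivation'' means a function of the form $x\mapsto D(x)+\lambda x$ with $D\in\mathscr{D}_k(\mathbb{F})$ for some $k\ge0$ and $\lambda\in\mathbb{C}$; its order is the smallest such $k$, so the functions $x\mapsto\lambda x$ have order $0$.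
   Formalization: (A) as printed (p2=p1-1) contradicts p1<p2, so it is proved up to interchanging the indices 1 and 2 (giving q1=q2+1, p1=p2-1); in (B) the relation c1·c2=-λ_{2,0}^{1-q1} is false and is corrected to c1·c2^{q1}=-λ_{2,0}^{1-q1}. *)

(* Defs.v *)
From HB Require Import structures.
From mathcomp Require Import all_boot all_order all_algebra.
From mathcomp Require Import reals.
From mathcomp Require Export complex.

Set Implicit Arguments.
Unset Strict Implicit.
Unset Printing Implicit Defensive.

Import Order.TTheory GRing.Theory Num.Theory.
Local Open Scope ring_scope.
Local Open Scope complex_scope.

(* [F : subFieldType S] is a subfield of R[i] with membership predicate [S]; the
   inclusion of F in R[i] is [\val]. *)

Definition is_additive (R : realType) (S : {pred R[i]}) (F : subFieldType S)
    (f : F -> R[i]) : Prop :=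
  forall x y : F, f (x + y) = f x + f y.

Definition is_derivation (R : realType) (S : {pred R[i]}) (F : subFieldType S)
    (d : F -> R[i]) : Prop :=
  is_additive d /\ forall x y : F, d (x * y) = d x * \val y + \val x * d y.

Fixpoint derivation_of_order (R : realType) (S : {pred R[i]})
    (F : subFieldType S) (k : nat) (f : F -> R[i]) : Prop :=
  match k with
  | 0 => forall x : F, f x = 0
  | k'.+1 =>
      is_additive f /\
      exists B : F -> F -> R[i],
        [/\ forall y : F, derivation_of_order k' (fun x => B x y),
            forall x : F, derivation_of_order k' (fun y => B x y)
          & forall x y : F,
              f (x * y) - \val x * f y - f x * \val y = B x y]
  end.

Definition derivation_plus_linear (R : realType) (S : {pred R[i]})
    (F : subFieldType S) (k : nat) (f : F -> R[i]) : Prop :=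
  exists (D : F -> R[i]) (lambda : R[i]),
    derivation_of_order k D /\ forall x : F, f x = D x + lambda * \val x.

Definition is_higher_order_derivation (R : realType) (S : {pred R[i]})
    (F : subFieldType S) (f : F -> R[i]) : Prop :=
  exists k : nat, derivation_plus_linear k f.

Definition has_order (R : realType) (S : {pred R[i]}) (F : subFieldType S)
    (f : F -> R[i]) (k : nat) : Prop :=
  derivation_plus_linear k f /\
  forall j : nat, derivation_plus_linear j f -> (k <= j)%N.

Definition order_at_most_one (R : realType) (S : {pred R[i]})
    (F : subFieldType S) (f : F -> R[i]) : Prop :=
  exists2 k : nat, has_order f k & (k <= 1)%N.

Definition not_identically_zero (R : realType) (S : {pred R[i]})
    (F : subFieldType S) (f : F -> R[i]) : Prop :=
  ~ (forall x : F, f x = 0).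

(* [lij] and [mij] stand for lambda_{i,j} and mu_{i,j}. *)

(* The last clause is a second description of the same solution, so it shares
   [d] and the coefficients with the first one. *)
Definition solution_A (R : realType) (S : {pred R[i]}) (F : subFieldType S)
    (p1 q1 p2 q2 : nat) (f1 g1 f2 g2 : F -> R[i]) : Prop :=
  exists (d : F -> R[i]) (l11 l10 l20 m11 m10 m21 m20 : R[i]),
    is_derivation d /\
    [/\ forall x : F, f1 x = l11 * d x + l10 * \val x,
        forall x : F, f2 x = l20 * \val x,
        forall x : F, g1 x = m11 * d x + m10 * \val x
      & forall x : F, g2 x = m21 * d x + m20 * \val x] /\
    [/\ l11 != 0, l20 != 0, m11 != 0 & m21 != 0] /\
    (q2 = q1 + 1)%N /\ (p2 = p1 - 1)%N /\
    p1%:R * l11 * m11 ^+ q1 + l20 * m21 ^+ (q1 + 1) = 0 /\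
    exists (h : F -> R[i]) (a : R[i]),
      (forall x : F, h x = d x + a * \val x) /\
      [/\ forall x : F, f1 (x ^+ p1) = l11 * p1%:R * h x * \val x ^+ (p1 - 1),
          forall x : F, g1 x = m11 * h x
        & forall x : F, g2 x = m21 * h x].

(* The relation between [c1] and [c2] is what remains of the equation once
   [f1 (x ^+ p1)] and [g1] are replaced by their expressions: [g1] occurs there
   to the power [q1], and so does [c2].  The exponent [1 - q1] is an integer. *)
Definition solution_B (R : realType) (S : {pred R[i]}) (F : subFieldType S)
    (p1 q1 p2 q2 N : nat) (f1 g1 f2 g2 : F -> R[i]) : Prop :=
  exists (d : F -> R[i]) (l11 l10 l20 m10 m21 m20 : R[i]),
    is_derivation d /\
    [/\ forall x : F, f1 x = l11 * d x + l10 * \val x,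
        forall x : F, f2 x = l20 * \val x,
        forall x : F, g1 x = m10 * \val x
      & forall x : F, g2 x = m21 * d x + m20 * \val x] /\
    [/\ l11 != 0, l20 != 0, m10 != 0 & m21 != 0] /\
    (q2 = 1)%N /\ (p2 = N - 1)%N /\
    p1%:R * l11 * m10 ^+ q1 + l20 * m21 = 0 /\
    exists c1 c2 : R[i],
      [/\ forall x : F, f1 (x ^+ p1) = c1 * g2 x * \val x ^+ (p1 - 1),
          forall x : F, g1 x = c2 * f2 x
        & c1 * c2 ^+ q1 = - (l20 ^ (1 - q1%:Z))].

Definition solution_C (R : realType) (S : {pred R[i]}) (F : subFieldType S)
    (p1 q1 p2 q2 : nat) (f1 g1 f2 g2 : F -> R[i]) : Prop :=
  exists (d : F -> R[i]) (l11 l10 l21 l20 m10 m20 : R[i]),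
    is_derivation d /\
    [/\ forall x : F, f1 x = l11 * d x + l10 * \val x,
        forall x : F, f2 x = l21 * d x + l20 * \val x,
        forall x : F, g1 x = m10 * \val x
      & forall x : F, g2 x = m20 * \val x] /\
    p1%:R * l11 * m10 ^+ q1 + p2%:R * l21 * m20 ^+ q2 = 0 /\
    l10 * m10 ^+ q1 + l20 * m20 ^+ q2 = 0 /\
    exists c : R[i],
      forall x : F, \val x ^+ (p2 - p1) * f1 (x ^+ p1) = c * f2 (x ^+ p2).

(* Main.v *)
Require Import Defs.
From mathcomp Require Import all_boot all_order all_algebra.
From mathcomp Require Import reals.
From mathcomp Require Import boolp ring zify.
Set Implicit Arguments.
Unset Strict Implicit.
Unset Printing Implicit Defensive.
Import Order.TTheory GRing.Theory Num.Theory.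
Local Open Scope ring_scope.
Local Open Scope complex_scope.

(* Two one-variable polynomial structures are played against each other.  On the
   one hand, f (x^n) / x^n is a polynomial in n when f is a higher order
   derivation.  On the other hand, f ((x + t)^p) and g (x + t) = g x + t g 1 are
   polynomials in t, by additivity alone.

   Replacing x by b x we may assume that all four functions are 1 at 1, so that
   the equation reads
     f1 ((x + t)^p1) (t + g1 x)^q1 = f2 ((x + t)^p2) (t + g2 x)^q2,  q1 > q2.
   Hence t + g1 x divides f2 ((x + t)^p2), and t + g2 x divides f1 ((x + t)^p1)
   as soon as g1 x <> g2 x.  Evaluated at t = - g (x), with x^n in place of x,
   such a divisibility becomes the polynomial identity in n
     sum_i C(p, i) (- G n)^i P ((p - i) n) = 0,
   where P and G stand for f and g.  Comparing degrees and leading coefficients,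
   and noting that G divides P (p n), it forces G to be constant or G and P to be
   of degree 1 with G - 1 = p (P - 1); so g x = x, or f - id is a derivation and
   g - id = p (f - id).  Cancelling the linear factors in t then leaves the three
   families of solutions. *)

(** * Polynomials determined by their values at natural numbers *)

Lemma poly_eq_nat (K : numFieldType) (P Q : {poly K}) :
  (forall n : nat, P.[n%:R] = Q.[n%:R]) -> P = Q.
Proof.
move=> PQ; apply/eqP; rewrite -subr_eq0; apply/eqP.
pose s := [seq i%:R : K | i <- iota 0 (size (P - Q))].
apply: (@roots_geq_poly_eq0 _ _ s); last by rewrite size_map size_iota.
- by apply/allP=> _ /mapP[n _ ->]; rewrite rootE hornerD hornerN PQ subrr.
- rewrite map_inj_uniq ?iota_uniq // => m n /eqP; by rewrite eqr_nat => /eqP.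
Qed.

Lemma coef_comp_polyZX (K : comNzRingType) (P : {poly K}) (c : K) i :
  (P \Po (c *: 'X))`_i = P`_i * c ^+ i.
Proof.
rewrite comp_polyE coef_sum.
under eq_bigr => j _ do rewrite exprZn !coefZ coefXn.
have [iP|iP] := ltnP i (size P).
  rewrite (bigD1 (Ordinal iP)) //= eqxx mulr1 big1 ?addr0 // => j nji.
  by rewrite (_ : (i == j) = false) ?mulr0 //; apply/negbTE; rewrite eq_sym.
rewrite nth_default // mul0r big1 // => j _.
by rewrite (_ : (i == j) = false) ?mulr0 //; apply/negbTE;
  rewrite neq_ltn (leq_trans (ltn_ord j) iP) orbT.
Qed.

Lemma poly_antidifference (K : numFieldType) (Q : {poly K}) :
  exists P : {poly K}, forall n : nat, P.[n.+1%:R] - P.[n%:R] = Q.[n%:R].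
Proof.
suff H s : forall Q : {poly K}, (size Q <= s)%N ->
    exists P : {poly K}, forall n : nat, P.[n.+1%:R] - P.[n%:R] = Q.[n%:R].
  exact: (H (size Q)).
elim: s => [|s IH] {}Q sQ.
  exists 0 => n; rewrite !horner0 subrr.
  by move: sQ; rewrite leqn0 size_poly_eq0 => /eqP ->; rewrite horner0.
pose c := Q`_s / s.+1%:R.
pose T : {poly K} := ('X + 1) ^+ s.+1 - 'X^(s.+1).
have TE i : T`_i = (if (i < s.+2)%N then 'C(s.+1, i)%:R else 0) - (i == s.+1)%:R.
  rewrite coefB coefXn; congr (_ - _).
  rewrite addrC exprDn -(coef_poly s.+2 (fun i => 'C(s.+1, i)%:R)) poly_def.
  congr ((_ : {poly K})`_ _). apply: eq_bigr => j _.
  by rewrite expr1n mul1r scaler_nat.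
have [|P PE] := IH (Q - c *: T).
  apply/leq_sizeP => j sj; rewrite coefB coefZ TE.
  have [->|jns] := eqVneq j s.
    by rewrite ltnS leqnSn (ltn_eqF (ltnSn s)) subr0 binSn divfK ?subrr // pnatr_eq0.
  have sj' : (s < j)%N by rewrite ltn_neqAle eq_sym jns.
  rewrite (nth_default _ (leq_trans sQ sj')) ltnS.
  have [->|jnS] := eqVneq j s.+1; first by rewrite leqnn binn subrr mulr0 subrr.
  have sj2 : (s.+1 < j)%N by rewrite ltn_neqAle eq_sym jnS.
  by rewrite leqNgt sj2 subrr mulr0 subrr.
exists (P + c *: 'X^(s.+1)) => n.
have := PE n; rewrite /T -(natr1 n) !hornerE => Pn.
by rewrite -[RHS](subrK (c * ((n%:R + 1) ^+ s.+1 - n%:R ^+ s.+1))) -Pn; ring.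
Qed.

(** The two highest powers of [G] dominate the sum and force [G] and p [P] to have the same leading
    term. The sum also shows that [G] divides P(pX); hence G = P(pX), and comparing leading
    coefficients leaves only degree 1. *)
Lemma proportional_of_divides_binomial_sum (K : numFieldType) (P G : {poly K}) (p : nat) :
  (1 < p)%N -> P.[0] = 1 -> G.[0] = 1 -> (1 < size G)%N ->
  \sum_(i < p.+1) 'C(p, i)%:R *: ((- G) ^+ i * (P \Po ((p - i)%:R *: 'X))) = 0 ->
  [/\ size P = 2, size G = 2 & G = p%:R *: P - (p%:R - 1)%:P].
Proof.
move=> p1 P0 G0 sG E.
have p0 : p%:R != 0 :> K by rewrite pnatr_eq0; case: p p1 {E}.
have Pn0 : P != 0 by apply: contra_eq_neq P0 => ->; rewrite horner0 eq_sym oner_eq0.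
have Gn0 : G != 0 by rewrite -size_poly_gt0 (ltn_trans _ sG).
have sPG : (size (G - p%:R *: P)%R < size P)%N.
  have [->|GP] := eqVneq (G - p%:R *: P) 0; first by rewrite size_poly0 size_poly_gt0.
  case: p p1 p0 E GP => [|[|r]] // _ p0.
  (* The summands i = p - 1 and i = p add up to (-G)^(p-1) (p P - G). The others have degree at most
     (p - 2) deg G + deg P, so deg (G - p P) <= deg P - deg G < deg P. *)
  rewrite big_ord_recr big_ord_recr /= subnn scale0r comp_polyCr P0 mulr1.
  rewrite binn scale1r subSS subSnn scale1r comp_polyXr binSn => E GP.
  set T := \sum_(i < _) _ in E.
  have sT : (size T <= r * (size G).-1 + size P)%N.
    apply: (leq_trans (size_sum _ _ _)); apply/bigmax_leqP => i _.
    apply: (leq_trans (size_scale_leq _ _)).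
    apply: (leq_trans (size_polyMleq _ _)).
    have si : (size ((- G) ^+ i)%R <= (size G).-1 * i + 1)%N.
      by rewrite addn1 -(size_polyN G) size_poly_exp_leq.
    have sc : (size (P \Po ((r.+2 - i)%:R *: 'X))%R <= size P)%N.
      by apply/leq_sizeP => j sj; rewrite coef_comp_polyZX nth_default ?mul0r.
    have mi : ((size G).-1 * i <= r * (size G).-1)%N.
      by rewrite mulnC leq_mul2r -ltnS ltn_ord orbT.
    rewrite -subn1 leq_subLR (leq_trans (leq_add si sc)) //.
    by rewrite addnAC addn1 ltnS leq_add2r.
  have : (- G) ^+ r.+1 * (G - r.+2%:R *: P) = T.
    rewrite -[LHS]addr0 -E (exprS _ r.+1).
    by rewrite -!mul_polyC; move: ((- G) ^+ _) => u; ring.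
  move=> ET; move: sT; rewrite -ET size_mul ?expf_neq0 ?oppr_eq0 //.
  have := size_exp (- G) r.+1; rewrite size_polyN.
  have : (0 < size ((- G) ^+ r.+1)%R)%N by rewrite size_poly_gt0 expf_neq0 ?oppr_eq0.
  move: sG; set a := size G; set b := size ((- G) ^+ _)%R; set e := size (G - _)%R.
  rewrite mulnS (mulnC r); set w := (_ * r)%N; move: (size P) => c; clearbody w a b e.
  by clear; lia.
have sGP : size G = size P.
  by rewrite -[G](subrK (p%:R *: P)) addrC size_polyDl size_scale.
(* The summand i = 0 is P(pX), and every other one carries a factor [G]. *)
have Gdvd : G %| P \Po (p%:R *: 'X).
  move: E; rewrite big_ord_recl expr0 mul1r bin0 scale1r subn0 => /eqP.
  rewrite addr_eq0 => /eqP ->; rewrite dvdpNr.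
  apply: (big_ind (fun x => G %| x)) => [|x y|i _]; [exact: dvdp0|exact: dvdp_add|].
  by rewrite lift0 dvdpZr ?pnatr_eq0 -?lt0n ?bin_gt0 // exprS -mulrA mulNr dvdpNr dvdp_mulr.
have GE : G = P \Po (p%:R *: 'X).
  have : G %= P \Po (p%:R *: 'X).
    rewrite -dvdp_size_eqp // sGP size_comp_poly2 // size_scale ?size_polyX //.
  case/eqpf_eq=> c c0 GE; move: (G0); rewrite GE hornerZ horner_comp hornerZ hornerX mulr0 P0 mulr1.
  by move=> ->; rewrite scale1r.
(* In degree k = deg P the polynomials P(pX) and p P agree, so p^k = p and k = 1. *)
have sP2 : size P = 2.
  set k := (size P).-1.
  have lP : P`_k != 0 by rewrite -[P`_k]/(lead_coef P) lead_coef_eq0.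
  have : (G - p%:R *: P)`_k = 0 by rewrite nth_default // -ltnS (leq_trans sPG) // leqSpred.
  rewrite coefB coefZ GE coef_comp_polyZX mulrC -mulrBl => /eqP.
  rewrite mulf_eq0 (negbTE lP) orbF subr_eq0 -natrX eqr_nat -{2}(expn1 p) eqn_exp2l //.
  by rewrite /k => /eqP; case: (size P) => [|[|[|]]].
split=> //; first by rewrite sGP.
apply/polyP=> i; rewrite {1}GE coef_comp_polyZX coefB coefZ coefC.
case: i => [|[|i]] /=.
- by rewrite expr0 -horner_coef0 P0; ring.
- by rewrite expr1 subr0 mulrC.
- by rewrite nth_default ?sP2 // mulr0 mul0r subr0.
Qed.

(** * Additive functions, derivations and divisibility in t *)

Lemma additiveMn (F : nzRingType) (K : nzRingType) (f : F -> K) (n : nat) (x : F) :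
  {morph f : x y / x + y} -> f (x *+ n) = n%:R * f x.
Proof.
move=> fD; elim: n => [|n IH]; last by rewrite mulrS fD IH -natr1 mulrDl mul1r addrC.
by rewrite mulr0n mul0r; apply: (@addrI _ (f 0)); rewrite -fD !addr0.
Qed.

(** A group is not the union of two proper subgroups, here the kernels of [f] and [g]. This turns
    pointwise alternatives into global ones. *)
Lemma additive_union (F K : nzRingType) (f g : F -> K) :
  {morph f : x y / x + y} -> {morph g : x y / x + y} ->
  (forall x, f x = 0 \/ g x = 0) -> (forall x, f x = 0) \/ (forall x, g x = 0).
Proof.
move=> fD gD fg; have [f0|/existsNP[x fx]] := pselect (forall x, f x = 0); first by left.
have gx : g x = 0 by case: (fg x).
right=> y; case: (fg y) => // fy; case: (fg (x + y)).
  by rewrite fD fy addr0 => /fx.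
by rewrite gD gx add0r.
Qed.

(** For [v] equal to [\val] this is [is_derivation]. *)
Definition derivation_along {F K : nzRingType} (v d : F -> K) : Prop :=
  {morph d : x y / x + y} /\ forall x y, d (x * y) = d x * v y + v x * d y.

(** Polarization: apply the hypothesis to x + y and compare the mixed terms. *)
Lemma derivation_of_square (F : fieldType) (K : numFieldType) (v : {rmorphism F -> K})
    (d : F -> K) :
  {morph d : x y / x + y} -> (forall x, d (x ^+ 2) = 2%:R * v x * d x) ->
  derivation_along v d.
Proof.
move=> dD d2; split=> // x y.
have := d2 (x + y); rewrite sqrrD !dD !d2 rmorphD /= => E.
apply: (@mulfI _ 2%:R); first by rewrite pnatr_eq0.
apply: (@addrI _ (2%:R * v x * d x + 2%:R * v y * d y)).
by apply: etrans (etrans _ E) _; ring.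
Qed.

(* The polynomial in t whose value is f ((x + t y)^p) at natural numbers t. *)
Definition binomial_poly {F K : nzRingType} (f : F -> K) (p : nat) (x y : F) : {poly K} :=
  \poly_(i < p.+1) ('C(p, i)%:R * f (x ^+ (p - i) * y ^+ i)).

Lemma horner_binomial_poly (F K : comNzRingType) (f : F -> K) (p : nat) (x y : F) (n : nat) :
  {morph f : x y / x + y} ->
  (binomial_poly f p x y).[n%:R] = f ((x + y *+ n) ^+ p).
Proof.
move=> fD; rewrite horner_poly exprDn.
have f0 : f 0 = 0 by rewrite -(mulr0n 0) additiveMn // mul0r.
rewrite (big_morph f fD f0); apply: eq_bigr => i _.
rewrite (exprMn_n y) mulrnAr !(additiveMn _ _ fD).
by rewrite natrX; ring.
Qed.

(** The factor [c] makes the property stable under replacing f by x |-> f (c x), as the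
    normalization of the equation requires. *)
Definition polynomial_along {F K : nzRingType} (v f : F -> K) : Prop :=
  forall c x, x != 0 ->
  exists P : {poly K}, forall n : nat, f (c * x ^+ n) = v x ^+ n * P.[n%:R].

(** For fixed x, let P(n) and G(n) be f (x^n) and g (x^n) divided by (v x)^n. Either G is constant,
    or the hypothesis at all powers of x is the polynomial identity that makes P and G linear. The
    alternative depends on x until [additive_union] is applied. *)
Lemma divides_binomial_poly (F : fieldType) (K : numFieldType) (v : {rmorphism F -> K})
    (f g : F -> K) (p : nat) :
  (1 < p)%N -> {morph f : x y / x + y} -> {morph g : x y / x + y} ->
  polynomial_along v f -> polynomial_along v g -> f 1 = 1 -> g 1 = 1 ->
  (forall x, g x != v x -> (binomial_poly f p x 1).[- g x] = 0) ->
  (forall x, g x = v x) \/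
  (forall x, g x - v x = p%:R * (f x - v x)) /\ derivation_along v (fun x => f x - v x).
Proof.
move=> p1 fD gD fP gP f1 g1 E.
have p0 : p%:R != 0 :> K by rewrite pnatr_eq0; case: p p1 {E}.
have f0 : f 0 = 0 by rewrite -(mulr0n 0) additiveMn // mul0r.
have g0 : g 0 = 0 by rewrite -(mulr0n 0) additiveMn // mul0r.
have pw x : (forall n, g (x ^+ n) = v x ^+ n) \/
    g x - v x = p%:R * (f x - v x) /\ f (x ^+ 2) - v x ^+ 2 = 2%:R * v x * (f x - v x).
  have [->|x0] := eqVneq x 0.
    by right; rewrite expr0n /= f0 g0 rmorph0 expr0n /= !subrr !mulr0.
  have vx0 : v x != 0 by rewrite fmorph_eq0.
  have [P PE] := fP 1 x x0; have [G GE] := gP 1 x x0.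
  have P0 : P.[0] = 1 by have := PE 0; rewrite expr0 mulr1 f1 expr0 mul1r.
  have G0 : G.[0] = 1 by have := GE 0; rewrite expr0 mulr1 g1 expr0 mul1r.
  have {}PE n : f (x ^+ n) = v x ^+ n * P.[n%:R] by rewrite -PE mul1r.
  have {}GE n : g (x ^+ n) = v x ^+ n * G.[n%:R] by rewrite -GE mul1r.
  have [sG|sG] := leqP (size G) 1.
    left=> n; rewrite GE; move: G0; rewrite (size1_polyC sG) !hornerC => ->.
    by rewrite mulr1.
  right.
  have EPG : \sum_(i < p.+1) 'C(p, i)%:R *: ((- G) ^+ i * (P \Po ((p - i)%:R *: 'X))) = 0.
    (* The hypothesis says nothing at those n with g (x^n) = v (x^n), that is G(n) = 1; the factor G
       - 1 covers them and is cancelled afterwards, [G] not being constant. *)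
    apply/eqP; have : (G - 1) * \sum_(i < p.+1)
        'C(p, i)%:R *: ((- G) ^+ i * (P \Po ((p - i)%:R *: 'X))) = 0.
      apply: poly_eq_nat => n; rewrite hornerM horner0 hornerD hornerN hornerC.
      have [->|Gn1] := eqVneq G.[n%:R] 1; first by rewrite subrr mul0r.
      have vn0 : v x ^+ n != 0 by rewrite expf_neq0.
      have /E : g (x ^+ n) != v (x ^+ n).
        by rewrite GE rmorphXn /= -subr_eq0 -{2}[v x ^+ n]mulr1 -mulrBr mulf_neq0 // subr_eq0.
      rewrite horner_poly horner_sum => Z.
      apply/eqP; rewrite mulf_eq0; apply/orP; right.
      apply/eqP/(mulfI (expf_neq0 p vn0)); rewrite mulr0 mulr_sumr -[RHS]Z; apply: eq_bigr => i _.
      rewrite hornerZ hornerM horner_exp hornerN horner_comp hornerZ hornerX expr1n mulr1.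
      rewrite -(exprM x) PE GE -natrM (mulnC n).
      have ip : (i <= p)%N by rewrite -ltnS.
      rewrite -mulrN exprMn -!(exprM (v x)).
      have -> : (n * p = (p - i) * n + n * i)%N by rewrite (mulnC _ n) -mulnDr subnK.
      rewrite exprD; ring.
    move/eqP; rewrite mulf_eq0 => /orP[|//]; rewrite subr_eq0 => /eqP G1.
    by move: sG; rewrite G1 size_poly1.
  have [sP _ GP] := proportional_of_divides_binomial_sum p1 P0 G0 sG EPG.
  have PX t : P.[t] = 1 + P`_1 * t.
    rewrite horner_coef sP !big_ord_recl big_ord0 /= -horner_coef0 P0 /bump /=.
    by rewrite !expr0 expr1 mulr1 addr0.
  have := PE 1; have := GE 1; rewrite !expr1 GP PE => -> ->.
  by rewrite !hornerE !PX; split; ring.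
have : (forall x, g x - v x = 0) \/ (forall x, g x - v x - p%:R * (f x - v x) = 0).
  apply: additive_union => [x y|x y|x].
  - by rewrite gD rmorphD /=; ring.
  - by rewrite fD gD rmorphD /=; ring.
  - case: (pw x) => [/(_ 1)|[-> _]]; last by right; rewrite subrr.
    by rewrite !expr1 => ->; left; rewrite subrr.
case=> [gv|gf]; first by left=> x; apply/eqP; rewrite -subr_eq0 gv.
right; split=> [x|]; first by apply/eqP; rewrite -subr_eq0 gf.
apply: derivation_of_square => [x y|x]; first by rewrite fD rmorphD /=; ring.
(* If g = v on all powers of x, then g - v = p (f - v) gives f = v there as well, and both sides
   vanish. *)
rewrite rmorphXn /=; case: (pw x) => [gx|[_ //]].
have fx n : f (x ^+ n) - v x ^+ n = 0.
  apply/eqP; have := gf (x ^+ n); rewrite gx rmorphXn /= subrr sub0r => /eqP.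
  by rewrite oppr_eq0 mulf_eq0 (negbTE p0).
by rewrite fx -(expr1 x) -[v _]expr1 expr1 fx mulr0.
Qed.

(** * Higher order derivations on geometric progressions *)

(** Induction on the order: the defect B (., x) has lower order, so the increments of n |-> f (c
    x^n) / x^n are polynomial in n, and so is the sequence itself. *)
Lemma derivation_of_order_polynomial_along (R : realType) (S : {pred R[i]})
    (F : subFieldType S) (k : nat) (f : F -> R[i]) :
  derivation_of_order k f ->
  {morph f : x y / x + y} /\ polynomial_along (\val : F -> R[i]) f.
Proof.
elim: k f => [|k IH] f /=.
  move=> f0; split=> [x y|c x _]; first by rewrite !f0 addr0.
  by exists 0 => n; rewrite f0 horner0 mulr0.
case=> fD [B [Bl _ BE]]; split=> // c x x0.
have vx0 : \val x != 0 :> R[i] by rewrite fmorph_eq0.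
have [_ /(_ c x x0) [Q QE]] := IH _ (Bl x).
(* The argument is the increment of f (c x^n) / x^n from n to n + 1; the constant added to [P] below
   adjusts the value at n = 0. *)
have [P PE] := poly_antidifference ((\val c * f x / \val x)%:P + (\val x)^-1 *: Q).
exists (P + (f c - P.[0])%:P) => n.
rewrite hornerD hornerC addrCA -[X in _ * (_ + X)]/(_ - _).
elim: n => [|n IHn]; first by rewrite expr0 mulr1 subrr addr0 expr0 mul1r.
have -> : P.[n.+1%:R] = P.[n%:R] + ((\val c * f x / \val x)%:P + (\val x)^-1 *: Q).[n%:R].
  by rewrite -PE addrC subrK.
rewrite exprSr mulrA.
have -> : f (c * x ^+ n * x) = \val (c * x ^+ n) * f x + f (c * x ^+ n) * \val x + B (c * x ^+ n) x.
  by rewrite -BE; ring.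
rewrite IHn QE rmorphM rmorphXn /= hornerD hornerC hornerZ exprS.
by field.
Qed.

Lemma higher_order_derivation_polynomial_along (R : realType) (S : {pred R[i]})
    (F : subFieldType S) (f : F -> R[i]) :
  is_higher_order_derivation f ->
  {morph f : x y / x + y} /\ polynomial_along (\val : F -> R[i]) f.
Proof.
case=> k [D [l [/derivation_of_order_polynomial_along [DD DP] fE]]]; split.
  by move=> x y; rewrite !fE DD rmorphD /=; ring.
move=> c x x0; have [P PE] := DP c x x0.
exists (P + (l * \val c)%:P) => n.
by rewrite fE PE rmorphM rmorphXn /= hornerD hornerC; ring.
Qed.

(** The order is the least admissible k, so it must be decided whether f is linear: if so it is 0,
    otherwise 1. *)
Lemma order_at_most_one_derivation (R : realType) (S : {pred R[i]}) (F : subFieldType S)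
    (f d : F -> R[i]) (l m : R[i]) :
  derivation_along (\val : F -> R[i]) d ->
  (forall x, f x = l * d x + m * \val x) -> order_at_most_one f.
Proof.
move=> [dD dM] fE.
have [[m' fm]|nlin] := pselect (exists m', forall x, f x = m' * \val x).
  exists 0%N => //; split=> //; exists (fun _ => 0), m'; split=> // x.
  by rewrite fm add0r.
exists 1%N => //; split.
  exists (fun x => l * d x), m; split=> //; split; first by move=> x y; rewrite dD mulrDr.
  by exists (fun _ _ => 0); split=> // x y; rewrite dM; ring.
case=> [[D [m' [/= D0 fm]]]|//]; case: nlin; exists m' => x.
by rewrite fm D0 add0r.
Qed.

(** * Additive functions on p-th powers *)

(** The coefficient of t in f ((1 + t x)^p) is p f(x). *)
Lemma additive_power_inj (F : comNzRingType) (K : numFieldType) (f h : F -> K) (p : nat) :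
  (0 < p)%N -> {morph f : x y / x + y} -> {morph h : x y / x + y} ->
  (forall x, f (x ^+ p) = h (x ^+ p)) -> forall x, f x = h x.
Proof.
move=> p0 fD hD fh x.
have : binomial_poly f p 1 x = binomial_poly h p 1 x.
  by apply: poly_eq_nat => n; rewrite !horner_binomial_poly.
move/(congr1 (fun P : {poly K} => P`_1)); rewrite !coef_poly ltnS p0 bin1 expr1n mul1r expr1.
by apply: mulfI; rewrite pnatr_eq0 -lt0n.
Qed.

Lemma derivation_alongX (F K : comNzRingType) (v : {rmorphism F -> K})
    (d : F -> K) (p : nat) (x : F) :
  derivation_along v d -> d (x ^+ p) = p%:R * v x ^+ p.-1 * d x.
Proof.
move=> [_ dM]; case: p => [|p].
  rewrite expr0 !mul0r; apply: (@addrI _ (d 1)).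
  by rewrite addr0 -[in RHS](mulr1 1) dM rmorph1 mulr1 mul1r.
elim: p => [|p IH]; first by rewrite expr1 expr0 !mul1r.
by rewrite exprS dM IH rmorphXn /= -(natr1 p.+1) exprS; ring.
Qed.

(** At y = x + t the Leibniz rule gives f (y^p) = (v y)^(p-1) (v y + p (f y - v y)) = (v y)^(p-1) g
    y. *)
Lemma binomial_poly_derivation (F : comNzRingType) (K : numFieldType) (v : {rmorphism F -> K})
    (f g : F -> K) (p : nat) (x : F) :
  (0 < p)%N -> {morph f : x y / x + y} -> {morph g : x y / x + y} -> g 1 = 1 ->
  (forall x, g x - v x = p%:R * (f x - v x)) ->
  derivation_along v (fun x => f x - v x) ->
  binomial_poly f p x 1 = ('X + (v x)%:P) ^+ p.-1 * ('X + (g x)%:P).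
Proof.
case: p => [//|p] _ fD gD g1 gf dd; apply: poly_eq_nat => n.
rewrite horner_binomial_poly // hornerM horner_exp !hornerD hornerX !hornerC.
set y := x + 1 *+ n.
have vy : v y = n%:R + v x by rewrite rmorphD rmorphMn rmorph1 addrC.
have gy : g y = n%:R + g x by rewrite gD (additiveMn _ _ gD) g1 mulr1 addrC.
rewrite -vy -gy -[f _](subrK (v (y ^+ p.+1))) (derivation_alongX p.+1 y dd).
rewrite mulrAC -gf rmorphXn /= exprS; ring.
Qed.

Lemma coef_scaled_compositions (K : numFieldType) (P : {poly K}) (a b : nat) (c : K) i :
  (0 < a < b)%N -> b%:R *: (P \Po (a%:R *: 'X)) = a%:R *: (P \Po (b%:R *: 'X)) + c%:P ->
  P`_i.+2 = 0.
Proof.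
move=> /andP[a0 ab] /(congr1 (fun Q : {poly K} => Q`_i.+2)).
rewrite coefD !coefZ !coef_comp_polyZX coefC addr0 => /eqP.
rewrite -subr_eq0 !(exprSr _ i.+1).
have -> : b%:R * (P`_i.+2 * (a%:R ^+ i.+1 * a%:R)) - a%:R * (P`_i.+2 * (b%:R ^+ i.+1 * b%:R))
  = P`_i.+2 * (a%:R * b%:R * (a%:R ^+ i.+1 - b%:R ^+ i.+1)) by ring.
rewrite mulf_eq0 => /orP[/eqP //|].
rewrite !mulf_eq0 !pnatr_eq0 !eqn0Ngt a0 (ltn_trans a0 ab) /= subr_eq0.
by rewrite -!natrX eqr_nat eqn_exp2r // (ltn_eqF ab).
Qed.

(** * The equation with linear g1 and g2 *)

Lemma linear_g_solutions (F : fieldType) (K : numFieldType) (v : {rmorphism F -> K})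
    (f1 f2 : F -> K) (p1 p2 : nat) :
  (0 < p1 < p2)%N -> {morph f1 : x y / x + y} -> {morph f2 : x y / x + y} ->
  polynomial_along v f1 -> f1 1 = 1 ->
  (forall x, f1 (x ^+ p1) * v x ^+ (p2 - p1) = f2 (x ^+ p2)) ->
  (forall x, p1%:R * (f1 x - v x) = p2%:R * (f2 x - v x)) /\
  derivation_along v (fun x => f1 x - v x).
Proof.
move=> /andP[p10 p12] f1D f2D f1P f11 E.
have p20 : (0 < p2)%N by exact: ltn_trans p12.
(* Put 1 + t x in place of x and compare the coefficients of t, read off as derivatives at 0. *)
have lin x : p1%:R * (f1 x - v x) = p2%:R * (f2 x - v x).
  have : binomial_poly f1 p1 1 x * (1 + v x *: 'X) ^+ (p2 - p1) = binomial_poly f2 p2 1 x.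
    apply: poly_eq_nat => n.
    rewrite hornerM horner_exp hornerD hornerZ hornerX hornerC !horner_binomial_poly // -E.
    by rewrite rmorphD rmorph1 rmorphMn /= mulr_natr.
  move/(congr1 (fun P : {poly K} => P^`().[0])).
  have B0 f p : (binomial_poly f p 1 x).[0] = f 1.
    by rewrite horner_coef0 coef_poly bin0 mul1r expr1n mul1r.
  have B1 f p : (0 < p)%N -> (binomial_poly f p 1 x)^`().[0] = p%:R * f x.
    by move=> p0; rewrite horner_coef0 coef_deriv coef_poly ltnS p0 bin1 expr1n mul1r expr1.
  rewrite derivM deriv_exp derivD derivC derivZ derivX add0r hornerD !hornerM B0 !B1 //.
  rewrite hornerMn hornerM !horner_exp !hornerD !hornerZ hornerX hornerC.
  rewrite mulr0 addr0 !expr1n !mulr1 f11 mul1r -(mulr_natl (v x)) natrB ?(ltnW p12) //.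
  by move=> H; rewrite !mulrBr -H; ring.
split=> //.
apply: derivation_of_square => [x y|x]; first by rewrite f1D rmorphD /=; ring.
have [->|x0] := eqVneq x 0.
  have f10 : f1 0 = 0 by rewrite -(mulr0n 0) (additiveMn _ _ f1D) mul0r.
  by rewrite expr0n /= f10 rmorph0 subrr mulr0.
have [P PE] := f1P 1 x x0.
have {}PE n : f1 (x ^+ n) = v x ^+ n * P.[n%:R] by rewrite -PE mul1r.
have vx0 : v x != 0 by rewrite fmorph_eq0.
have P0 : P.[0] = 1 by have := PE 0; rewrite expr0 f11 expr0 mul1r.
(* Eliminating f2 by [lin] from the equation at x^n yields p2 P(p1 n) = p1 P(p2 n) + (p2 - p1), so
   [P] has degree at most 1. *)
have Pi i : P`_i.+2 = 0.
  apply: (@coef_scaled_compositions _ _ p1 p2 (p2%:R - p1%:R)); first by rewrite p10.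
  apply: poly_eq_nat => n.
  rewrite hornerD !hornerZ !horner_comp !hornerZ !hornerX hornerC.
  have := lin (x ^+ (n * p2)); have := E (x ^+ n).
  rewrite -!(exprM x) => <-; rewrite !PE !rmorphXn /= -!(exprM (v x)).
  rewrite -!natrM !(mulnC n) => H.
  apply: (@mulfI _ (v x ^+ (p2 * n))); first by rewrite expf_neq0.
  rewrite mulrAC -exprD -mulnDl subnKC ?(ltnW p12) // in H.
  move: H; set w := v x ^+ _; set a := P.[_]; set b := P.[_] => H.
  have -> : w * (p1%:R * a + (p2%:R - p1%:R)) = p1%:R * (w * a - w) + p2%:R * w by ring.
  by rewrite H; ring.
have sP : (size P <= 2)%N by apply/leq_sizeP => [[|[|j]]].
have PX t : P.[t] = 1 + P`_1 * t.
  rewrite (horner_coef_wide _ sP) !big_ord_recl big_ord0 /= -horner_coef0 P0 /bump /=.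
  by rewrite !expr0 expr1 mulr1 addr0.
have := PE 1; rewrite !expr1 => ->; rewrite PE rmorphXn /= !PX; ring.
Qed.

(** * The equation normalized at 1 *)

Lemma normalized_solutions (F : fieldType) (K : numFieldType) (v : {rmorphism F -> K})
    (f1 f2 g1 g2 : F -> K) (p1 p2 q1 q2 : nat) :
  (0 < p1 < p2)%N -> (0 < q2)%N -> (p1 + q1 = p2 + q2)%N -> p1 <> q2 ->
  {morph f1 : x y / x + y} -> {morph f2 : x y / x + y} ->
  {morph g1 : x y / x + y} -> {morph g2 : x y / x + y} ->
  polynomial_along v f1 -> polynomial_along v f2 ->
  polynomial_along v g1 -> polynomial_along v g2 ->
  f1 1 = 1 -> f2 1 = 1 -> g1 1 = 1 -> g2 1 = 1 ->
  (forall x, f1 (x ^+ p1) * g1 x ^+ q1 = f2 (x ^+ p2) * g2 x ^+ q2) ->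
  exists2 D : F -> K, derivation_along v D &
  [\/ (q1 = q2 + 1)%N /\
      forall x, [/\ f1 x = v x, f2 x = v x + D x,
        g1 x = v x + p2%:R * D x & g2 x = v x + p2%:R * D x],
      q2 = 1%N /\
      forall x, [/\ f1 x = v x + D x, f2 x = v x,
        g1 x = v x & g2 x = v x + p1%:R * D x]
    | forall x, [/\ f1 x = v x + p2%:R * D x, f2 x = v x + p1%:R * D x,
        g1 x = v x & g2 x = v x]].
Proof.
move=> /andP[p10 p12] q20 pq p1q2 f1D f2D g1D g2D f1P f2P g1P g2P f11 f21 g11 g21 E.
have p20 : (0 < p2)%N by exact: ltn_trans p12.
have q12 : (q2 < q1)%N by rewrite -(ltn_add2l p1) pq ltn_add2r.
have vD : {morph v : x y / x + y} by exact: rmorphD.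
have shift (g : F -> K) x n : {morph g : x y / x + y} -> g 1 = 1 ->
    g (x + 1 *+ n) = ('X + (g x)%:P).[n%:R].
  by move=> gD g1'; rewrite gD (additiveMn _ _ gD) g1' mulr1 hornerD hornerX hornerC addrC.
have L0 (c : K) : 'X + c%:P != 0.
  by rewrite -size_poly_gt0 size_XaddC.
pose A1 x := binomial_poly f1 p1 x 1; pose A2 x := binomial_poly f2 p2 x 1.
have Et x : A1 x * ('X + (g1 x)%:P) ^+ q1 = A2 x * ('X + (g2 x)%:P) ^+ q2.
  apply: poly_eq_nat => n.
  by rewrite !hornerM !horner_exp !horner_binomial_poly // -!shift // E.
have root_neq (a b : K) k : a != b -> ('X + a%:P).[- b] ^+ k != 0.
  by move=> ab; rewrite expf_neq0 // hornerD hornerX hornerC addrC subr_eq0.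
have root_eq (a : K) k : (0 < k)%N -> ('X + a%:P).[- a] ^+ k = 0.
  by move=> k0; rewrite hornerD hornerX hornerC addNr expr0n eqn0Ngt k0.
(* If g1 x = g2 x, cancelling q2 factors still leaves q1 - q2 > 0 factors t + g1 x on the left. *)
have A2g1 x : (A2 x).[- g1 x] = 0.
  have [g12|g12] := eqVneq (g2 x) (g1 x).
    have := Et x; rewrite g12 -(subnK (ltnW q12)) exprD mulrA.
    move/(mulIf (expf_neq0 q2 (L0 _))) => <-.
    by rewrite hornerM horner_exp root_eq ?mulr0 // subn_gt0.
  have /eqP := congr1 (horner^~ (- g1 x)) (Et x).
  rewrite !hornerM !horner_exp root_eq ?(ltn_trans q20) // mulr0 eq_sym mulf_eq0.
  by rewrite (negbTE (root_neq _ _ _ g12)) orbF => /eqP.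
have [g1v|ng1v] := pselect (forall x, g1 x = v x); last first.
  have [//|[gf dD]] : (forall x, g1 x = v x) \/
      (forall x, g1 x - v x = p2%:R * (f2 x - v x)) /\
      derivation_along v (fun x => f2 x - v x).
    by apply: divides_binomial_poly => //; [exact: leq_ltn_trans p10 p12|move=> x _; exact: A2g1].
  exists (fun x => f2 x - v x) => //; constructor 1.
  have A2E x : A2 x = ('X + (v x)%:P) ^+ p2.-1 * ('X + (g1 x)%:P).
    exact: binomial_poly_derivation.
  case: q1 q12 pq E Et => [//|q1] q12 pq E Et.
  have {}Et x : A1 x * ('X + (g1 x)%:P) ^+ q1 = ('X + (v x)%:P) ^+ p2.-1 * ('X + (g2 x)%:P) ^+ q2.
    apply: (mulIf (L0 (g1 x))); rewrite -mulrA -exprSr Et A2E; ring.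
  have q1_gt0 : (0 < q1)%N by exact: leq_trans q20 q12.
  (* A factor t + g1 x remains on the left, while the roots on the right are among - v x and - g2 x.
     As g1 <> v, [additive_union] gives g1 = g2. *)
  have g21E x : g2 x = g1 x.
    have [H|H] : (forall x, g1 x - v x = 0) \/ (forall x, g1 x - g2 x = 0).
    - apply: additive_union => [x' y'|x' y'|x'].
      + by rewrite g1D vD; ring.
      + by rewrite g1D g2D; ring.
      have [/eqP|vg] := eqVneq (v x') (g1 x'); first by rewrite eq_sym -subr_eq0 => /eqP; left.
      have [/eqP|g2g] := eqVneq (g2 x') (g1 x'); first by rewrite eq_sym -subr_eq0 => /eqP; right.
      have /eqP := congr1 (horner^~ (- g1 x')) (Et x').
      rewrite !hornerM !horner_exp root_eq // mulr0 eq_sym mulf_eq0.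
      by rewrite (negbTE (root_neq _ _ _ vg)) (negbTE (root_neq _ _ _ g2g)).
    - by case: ng1v => y; apply/eqP; rewrite -subr_eq0 H.
    - by apply/esym/eqP; rewrite -subr_eq0 H.
  have {}Et x : A1 x * ('X + (g1 x)%:P) ^+ (q1 - q2) = ('X + (v x)%:P) ^+ p2.-1.
    apply: (mulIf (expf_neq0 q2 (L0 (g1 x)))).
    by rewrite -mulrA -exprD subnK // Et g21E.
  (* A further factor t + g1 x would divide a power of t + v x, again forcing g1 = v. *)
  have q1E : q1 = q2.
    apply/eqP; rewrite eqn_leq (q12 : (q2 <= q1)%N) andbT leqNgt; apply/negP => qlt.
    case: ng1v => x; apply/esym/eqP/negPn/negP => /root_neq - /(_ p2.-1).
    by rewrite -horner_exp -Et hornerM horner_exp root_eq ?subn_gt0 // mulr0 eqxx.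
  split; first by rewrite q1E addn1.
  have f1v : forall x, f1 x = v x.
    apply: (additive_power_inj p10 f1D vD) => x.
    have := congr1 (horner^~ 0%:R) (Et x).
    rewrite q1E subnn mulr1 horner_binomial_poly // mulr0n addr0 => ->.
    rewrite horner_exp hornerD hornerX hornerC add0r rmorphXn /=; congr (_ ^+ _); lia.
  by move=> x; split; rewrite ?f1v ?g21E -?gf //; ring.
have A1g2 x : g2 x != v x -> (A1 x).[- g2 x] = 0.
  rewrite eq_sym => gv; have /eqP := congr1 (horner^~ (- g2 x)) (Et x).
  rewrite g1v !hornerM !horner_exp root_eq // mulr0 mulf_eq0.
  by rewrite (negbTE (root_neq _ _ _ gv)) orbF => /eqP.
have [g2v|ng2v] := pselect (forall x, g2 x = v x).
  have Ev x : f1 (x ^+ p1) * v x ^+ (p2 - p1) = f2 (x ^+ p2).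
    have [->|x0] := eqVneq x 0.
      have f20 : f2 0 = 0 by rewrite -(mulr0n 0) (additiveMn _ _ f2D) mul0r.
      by rewrite rmorph0 !expr0n !eqn0Ngt subn_gt0 p12 p20 /= mulr0 f20.
    apply: (@mulIf _ (v x ^+ q2)); first by rewrite expf_neq0 // fmorph_eq0.
    rewrite -mulrA -exprD -[in RHS]g2v -E g1v; congr (_ * _ ^+ _); lia.
  have [lin [dD dM]] := linear_g_solutions (introT andP (conj p10 p12)) f1D f2D f1P f11 Ev.
  have p2n0 : p2%:R != 0 :> K by rewrite pnatr_eq0 -lt0n.
  (* With this scaling [lin] reads f2 - v = p1 D. *)
  exists (fun x => (f1 x - v x) / p2%:R).
    by split=> x y; rewrite ?dD ?dM; field.
  constructor 3 => x; split=> //; first by field.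
  apply: (@mulfI _ p2%:R) => //.
  have -> : p2%:R * (v x + p1%:R * ((f1 x - v x) / p2%:R))
    = p2%:R * v x + p1%:R * (f1 x - v x) by field.
  by rewrite lin; ring.
(* Where g2 x <> v x, the left side has - g2 x as a simple root only. *)
have q2_eq1 (k : nat) : (forall x, g2 x != v x ->
    ('X + (v x)%:P) ^+ k * ('X + (g2 x)%:P) = A2 x * ('X + (g2 x)%:P) ^+ q2) -> q2 = 1%N.
  move=> H; apply/eqP; rewrite eqn_leq q20 andbT leqNgt; apply/negP => q2_gt1.
  case: ng2v => x; apply/eqP/negPn/negP => gv.
  have := H x gv; rewrite -(subnK q20) addn1 exprSr mulrA => /(mulIf (L0 _)).
  move/(congr1 (horner^~ (- g2 x))); rewrite hornerM !horner_exp root_eq ?subn_gt0 // mulr0.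
  by apply/eqP; rewrite root_neq // eq_sym.
(* Here p1 <> q2 enters: if p1 = 1, then A1 x = t + f1 x vanishes at - g2 x, so f1 x = g2 x wherever
   g2 x <> v x, and [q2_eq1] gives q2 = 1 = p1. *)
have p1_gt1 : (1 < p1)%N.
  rewrite ltn_neqAle p10 andbT; apply/eqP => p1E; case: p1q2.
  rewrite -p1E; apply/esym/(q2_eq1 q1) => x gv.
  rewrite -Et g1v mulrC; congr (_ * _).
  have A1E : A1 x = 'X + (f1 x)%:P.
    by apply: poly_eq_nat => n; rewrite horner_binomial_poly // -p1E expr1 shift.
  have := A1g2 x gv; rewrite A1E hornerD hornerX hornerC addrC => /eqP.
  by rewrite subr_eq0 => /eqP ->.
have [//|[gf dD]] : (forall x, g2 x = v x) \/
    (forall x, g2 x - v x = p1%:R * (f1 x - v x)) /\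
    derivation_along v (fun x => f1 x - v x).
  by apply: divides_binomial_poly.
exists (fun x => f1 x - v x) => //; constructor 2.
have {}Et x : ('X + (v x)%:P) ^+ (p1.-1 + q1) * ('X + (g2 x)%:P) = A2 x * ('X + (g2 x)%:P) ^+ q2.
  by rewrite -Et /A1 (binomial_poly_derivation x p10 f1D g2D g21 gf dD) g1v exprD; ring.
have q2E : q2 = 1%N by apply: (q2_eq1 (p1.-1 + q1)%N).
split=> //; have f2v : forall x, f2 x = v x.
  apply: (additive_power_inj p20 f2D vD) => x.
  have := Et x; rewrite q2E => /(mulIf (L0 _)) /(congr1 (horner^~ 0%:R)).
  rewrite horner_binomial_poly // mulr0n addr0 => <-.
  rewrite horner_exp hornerD hornerX hornerC add0r rmorphXn /=; congr (_ ^+ _); lia.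
by move=> x; split; rewrite ?f2v ?g1v -?gf //; ring.
Qed.

(** * Normalization at a point b and return to the original functions *)

(** On the line u + t (w - u) both expressions are polynomials in t, nonzero at t = 0 and t = 1
    respectively, so their product is nonzero at some natural t. *)
Lemma common_nonzero (F : comNzRingType) (K : numFieldType) (f g : F -> K) (p : nat) :
  (0 < p)%N -> {morph f : x y / x + y} -> {morph g : x y / x + y} ->
  ~ (forall x, f x = 0) -> ~ (forall x, g x = 0) ->
  exists2 b, f (b ^+ p) != 0 & g b != 0.
Proof.
move=> p0 fD gD fn0 /existsNP[w /eqP gw].
have [u fu] : exists u, f (u ^+ p) != 0.
  apply: contrapT => /forallNP f0; apply: fn0.
  apply: (@additive_power_inj _ _ f (fun _ => 0) p) => // [x y|x]; first by rewrite addr0.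
  by apply/eqP/negPn/negP; exact: f0.
apply: contrapT => H.
have Z : binomial_poly f p u (w - u) * binomial_poly g 1 u (w - u) = 0.
  apply: poly_eq_nat => n; rewrite hornerM !horner_binomial_poly // expr1 horner0.
  apply/eqP; rewrite mulf_eq0 -[X in X || _]negbK -[X in _ || X]negbK -negb_and.
  by apply/negP => /andP[fb gb]; apply: H; exists (u + (w - u) *+ n).
move/eqP: Z; rewrite mulf_eq0 => /orP[] /eqP Z.
  have := horner_binomial_poly p u (w - u) 0 fD.
  by rewrite Z horner0 mulr0n addr0 => /esym/eqP; rewrite (negbTE fu).
have := horner_binomial_poly 1 u (w - u) 1 gD.
by rewrite Z horner0 mulr1n addrC subrK expr1 => /esym/eqP; rewrite (negbTE gw).
Qed.

Lemma polynomial_along_translate (F : comNzRingType) (K : fieldType) (v f : F -> K)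
    (c : F) (m : K) :
  polynomial_along v f -> polynomial_along v (fun x => f (c * x) / m).
Proof.
move=> fP e x x0; have [P PE] := fP (c * e) x x0.
by exists (m^-1 *: P) => n; rewrite mulrA PE hornerZ; ring.
Qed.

(** Substitute x / b^p; by the Leibniz rule, b^p D (x / b^p) = D x - p (D b / b) x, which creates
    the linear term. *)
Lemma untranslate (F K : fieldType) (v : {rmorphism F -> K}) (f D : F -> K)
    (k : K) (b : F) (p : nat) :
  derivation_along v D -> b != 0 -> f (b ^+ p) != 0 ->
  (forall x, f (b ^+ p * x) / f (b ^+ p) = v x + k * D x) ->
  forall x, f x = f (b ^+ p) / v b ^+ p * (k * D x + (1 - k * p%:R * (D b / v b)) * v x).
Proof.
move=> dD b0 fb0 E x.
have vb0 : v b != 0 by rewrite fmorph_eq0.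
have bp0 : b ^+ p != 0 by rewrite expf_neq0.
have vbp0 : v b ^+ p != 0 by rewrite expf_neq0.
have := E (x / b ^+ p); rewrite [b ^+ p * _]mulrC divfK // => /(canRL (divfK fb0)) ->.
have := dD.2 (b ^+ p) (x / b ^+ p); rewrite [b ^+ p * _]mulrC divfK //.
rewrite (derivation_alongX p b dD) rmorphM fmorphV rmorphXn /= => ->.
move: (D (x / _)) (f _) => e m; case: p {E fb0 bp0} vbp0 => [|p] vbp0.
  rewrite !expr0 !divr1; ring.
rewrite [v b ^+ p.+1]exprS /=; field.
by rewrite vb0 expf_neq0.
Qed.

(* (A) is stated for both labellings of the two terms of the equation: the
   second one is the labelling compatible with p1 < p2. *)
Theorem theorem9 (R : realType) (S : {pred R[i]}) (F : subFieldType S)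
    (p1 p2 q1 q2 N : nat) (f1 f2 g1 g2 : F -> R[i])
    (p1_gt0 : (0 < p1)%N) (p2_gt0 : (0 < p2)%N)
    (q1_gt0 : (0 < q1)%N) (q2_gt0 : (0 < q2)%N)
    (lt_p1_p2 : (p1 < p2)%N)
    (p1_q1_N : (p1 + q1 = N)%N) (p2_q2_N : (p2 + q2 = N)%N)
    (p1_neq_q2 : p1 <> q2) (p2_neq_q1 : p2 <> q1)
    (f1_hod : is_higher_order_derivation f1)
    (f2_hod : is_higher_order_derivation f2)
    (g1_hod : is_higher_order_derivation g1)
    (g2_hod : is_higher_order_derivation g2)
    (f1_neq0 : not_identically_zero f1) (f2_neq0 : not_identically_zero f2)
    (g1_neq0 : not_identically_zero g1) (g2_neq0 : not_identically_zero g2)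
    (equation : forall x : F,
       f1 (x ^+ p1) * g1 x ^+ q1 + f2 (x ^+ p2) * g2 x ^+ q2 = 0) :
  [/\ order_at_most_one f1, order_at_most_one f2,
      order_at_most_one g1 & order_at_most_one g2] /\
  [\/ solution_A p1 q1 p2 q2 f1 g1 f2 g2
        \/ solution_A p2 q2 p1 q1 f2 g2 f1 g1,
      solution_B p1 q1 p2 q2 N f1 g1 f2 g2
    | solution_C p1 q1 p2 q2 f1 g1 f2 g2].
Proof.
have [f1D f1P] := higher_order_derivation_polynomial_along f1_hod.
have [f2D f2P] := higher_order_derivation_polynomial_along f2_hod.
have [g1D g1P] := higher_order_derivation_polynomial_along g1_hod.
have [g2D g2P] := higher_order_derivation_polynomial_along g2_hod.
have [b fb1 gb1] := common_nonzero p1_gt0 f1D g1D f1_neq0 g1_neq0.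
have b0 : b != 0.
  by apply: contra_neq gb1 => ->; rewrite -(mulr0n 0) (additiveMn _ _ g1D) mul0r.
have /andP[fb2 gb2] : (f2 (b ^+ p2) != 0) && (g2 b != 0).
  rewrite -negb_or; apply/negP => fg; have := equation b.
  have -> : f2 (b ^+ p2) * g2 b ^+ q2 = 0.
    by case/orP: fg => /eqP ->; rewrite ?expr0n ?eqn0Ngt ?q2_gt0 ?mul0r ?mulr0.
  by move/eqP; rewrite addr0 mulf_eq0 (negbTE fb1) expf_eq0 (negbTE gb1) andbF.
have trD (f : F -> R[i]) c m : {morph f : x y / x + y} ->
    {morph (fun x => f (c * x) / m) : x y / x + y}.
  by move=> fD x y /=; rewrite mulrDr fD mulrDl.
have tr1 (f : F -> R[i]) c : f c != 0 -> f (c * 1) / f c = 1.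
  by move=> fc; rewrite mulr1 divff.
have eqb : f2 (b ^+ p2) * g2 b ^+ q2 = - (f1 (b ^+ p1) * g1 b ^+ q1).
  by apply/eqP; rewrite -addr_eq0 addrC equation.
have vb0 : \val b != 0 :> R[i] by rewrite fmorph_eq0.
have vX k : \val b ^+ k != 0 :> R[i] by rewrite expf_neq0.
pose a1 := f1 (b ^+ p1) / \val b ^+ p1; pose a2 := f2 (b ^+ p2) / \val b ^+ p2.
pose b1 := g1 b / \val b; pose b2 := g2 b / \val b.
have a1n0 : a1 != 0 by rewrite mulf_neq0 ?invr_eq0.
have a2n0 : a2 != 0 by rewrite mulf_neq0 ?invr_eq0.
have b1n0 : b1 != 0 by rewrite mulf_neq0 ?invr_eq0.
have b2n0 : b2 != 0 by rewrite mulf_neq0 ?invr_eq0.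
(* This is the equation at b divided by b^N; all coefficient relations below are multiples of it. *)
have rel : a1 * b1 ^+ q1 + a2 * b2 ^+ q2 = 0.
  rewrite /a1 /a2 /b1 /b2 !expr_div_n !mulf_div -!exprD p1_q1_N p2_q2_N -mulrDl.
  by rewrite equation mul0r.
have neq x : f1 (b ^+ p1 * x ^+ p1) / f1 (b ^+ p1) * (g1 (b * x) / g1 b) ^+ q1
    = f2 (b ^+ p2 * x ^+ p2) / f2 (b ^+ p2) * (g2 (b * x) / g2 b) ^+ q2.
  rewrite -!exprMn !expr_div_n !mulf_div eqb invrN mulrN -mulNr.
  by congr (_ / _); apply/eqP; rewrite -addr_eq0 equation.
have [D dD HD] := @normalized_solutions _ _ (\val : {rmorphism F -> R[i]})
  (fun x => f1 (b ^+ p1 * x) / f1 (b ^+ p1)) (fun x => f2 (b ^+ p2 * x) / f2 (b ^+ p2))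
  (fun x => g1 (b * x) / g1 b) (fun x => g2 (b * x) / g2 b) p1 p2 q1 q2
  (introT andP (conj p1_gt0 lt_p1_p2)) q2_gt0 (etrans p1_q1_N (esym p2_q2_N)) p1_neq_q2
  (trD _ _ _ f1D) (trD _ _ _ f2D) (trD _ _ _ g1D) (trD _ _ _ g2D)
  (polynomial_along_translate _ _ f1P) (polynomial_along_translate _ _ f2P)
  (polynomial_along_translate _ _ g1P) (polynomial_along_translate _ _ g2P)
  (tr1 _ _ fb1) (tr1 _ _ fb2) (tr1 _ _ gb1) (tr1 _ _ gb2) neq.
pose s := D b / \val b.
have UF (f : F -> R[i]) k p : f (b ^+ p) != 0 ->
    (forall x, f (b ^+ p * x) / f (b ^+ p) = \val x + k * D x) ->
    forall x, f x = f (b ^+ p) / \val b ^+ p * k * D x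
      + f (b ^+ p) / \val b ^+ p * (1 - k * p%:R * s) * \val x.
  by move=> fb H x; rewrite {1}(untranslate dD b0 fb H) /s; ring.
have UG (g : F -> R[i]) k : g b != 0 ->
    (forall x, g (b * x) / g b = \val x + k * D x) ->
    forall x, g x = g b / \val b * k * D x + g b / \val b * (1 - k * s) * \val x.
  by move=> gb H x; rewrite {1}(UF g k 1 gb H) mulr1.
have DX x p : D (x ^+ p) = p%:R * \val x ^+ p.-1 * D x by exact: derivation_alongX.
have p12 : (p1%:R != 0 :> R[i]) && (p2%:R != 0 :> R[i]).
  by rewrite !pnatr_eq0 -!lt0n p1_gt0.
case/andP: p12 => p1n0 p2n0.
case: HD => [[q1E H]|[q2E H]|H].
- have f1E x : f1 x = a1 * 0 * D x + a1 * (1 - 0 * p1%:R * s) * \val x.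
    by apply: UF => // y; have [-> _ _ _] := H y; rewrite mul0r addr0.
  have f2E x : f2 x = a2 * 1 * D x + a2 * (1 - 1 * p2%:R * s) * \val x.
    by apply: UF => // y; have [_ -> _ _] := H y; rewrite mul1r.
  have g1E x : g1 x = b1 * p2%:R * D x + b1 * (1 - p2%:R * s) * \val x.
    by apply: UG => // y; have [_ _ -> _] := H y.
  have g2E x : g2 x = b2 * p2%:R * D x + b2 * (1 - p2%:R * s) * \val x.
    by apply: UG => // y; have [_ _ _ ->] := H y.
  clearbody a1 a2 b1 b2 s.
  split.
    by split; apply: order_at_most_one_derivation dD _;
      [exact: f1E|exact: f2E|exact: g1E|exact: g2E].
  (* Here q1 = q2 + 1, hence p1 = p2 - 1: family (A) with the two terms exchanged. *)
  constructor 1; right.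
  exists D, a2, (a2 * (1 - p2%:R * s)), a1, (b2 * p2%:R), (b2 * (1 - p2%:R * s)),
    (b1 * p2%:R), (b1 * (1 - p2%:R * s)).
  split; first exact: dD.
  split; first by split=> x; rewrite ?f1E ?f2E ?g1E ?g2E //; ring.
  split; first by split=> //; rewrite mulf_neq0.
  split; first exact: q1E.
  split; first by clear -q1E p1_q1_N p2_q2_N; lia.
  split.
    have -> : p2%:R * a2 * (b2 * p2%:R) ^+ q2 + a1 * (b1 * p2%:R) ^+ (q2 + 1)
      = p2%:R ^+ (q2 + 1) * (a1 * b1 ^+ q1 + a2 * b2 ^+ q2).
      by rewrite q1E !exprMn !exprD !expr1; ring.
    by rewrite rel mulr0.
  (* The constant is the common ratio of the linear to the derivation coefficient in g1 and g2. *)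
  exists (fun x => D x + (1 - p2%:R * s) / p2%:R * \val x), ((1 - p2%:R * s) / p2%:R).
  split=> //; split=> x.
  + rewrite f2E DX rmorphXn /= subn1 -[in \val x ^+ p2](prednK p2_gt0) exprS; field.
    by [].
  + by rewrite g2E; field.
  + by rewrite g1E; field.
- have f1E x : f1 x = a1 * 1 * D x + a1 * (1 - 1 * p1%:R * s) * \val x.
    by apply: UF => // y; have [-> _ _ _] := H y; rewrite mul1r.
  have f2E x : f2 x = a2 * 0 * D x + a2 * (1 - 0 * p2%:R * s) * \val x.
    by apply: UF => // y; have [_ -> _ _] := H y; rewrite mul0r addr0.
  have g1E x : g1 x = b1 * 0 * D x + b1 * (1 - 0 * s) * \val x.
    by apply: UG => // y; have [_ _ -> _] := H y; rewrite mul0r addr0.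
  have g2E x : g2 x = b2 * p1%:R * D x + b2 * (1 - p1%:R * s) * \val x.
    by apply: UG => // y; have [_ _ _ ->] := H y.
  clearbody a1 a2 b1 b2 s.
  split.
    by split; apply: order_at_most_one_derivation dD _;
      [exact: f1E|exact: f2E|exact: g1E|exact: g2E].
  constructor 2.
  exists D, a1, (a1 * (1 - p1%:R * s)), a2, b1, (b2 * p1%:R), (b2 * (1 - p1%:R * s)).
  split; first exact: dD.
  split; first by split=> x; rewrite ?f1E ?f2E ?g1E ?g2E //; ring.
  split; first by split=> //; rewrite mulf_neq0.
  split; first exact: q2E.
  split; first by clear -q2E p2_q2_N; lia.
  rewrite q2E expr1 in rel.
  split.
    have -> : p1%:R * a1 * b1 ^+ q1 + a2 * (b2 * p1%:R) = p1%:R * (a1 * b1 ^+ q1 + a2 * b2) by ring.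
    by rewrite rel mulr0.
  exists (a1 / b2), (b1 / a2); split=> [x|x|].
  + rewrite f1E DX g2E rmorphXn /= subn1 -[in \val x ^+ p1](prednK p1_gt0) exprS; field.
    by [].
  + by rewrite g1E f2E; field.
  (* By [rel], a1 b1^q1 = - a2 b2, so c1 c2^q1 = - a2 / a2^q1. *)
  + rewrite expfzDr // expr1z -exprnN expr_div_n.
    move/eqP: rel; rewrite addr_eq0 mulf_div => /eqP ->.
    by field; rewrite b2n0 expf_neq0.
- have f1E x : f1 x = a1 * p2%:R * D x + a1 * (1 - p2%:R * p1%:R * s) * \val x.
    by apply: UF => // y; have [-> _ _ _] := H y.
  have f2E x : f2 x = a2 * p1%:R * D x + a2 * (1 - p1%:R * p2%:R * s) * \val x.
    by apply: UF => // y; have [_ -> _ _] := H y.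
  have g1E x : g1 x = b1 * 0 * D x + b1 * (1 - 0 * s) * \val x.
    by apply: UG => // y; have [_ _ -> _] := H y; rewrite mul0r addr0.
  have g2E x : g2 x = b2 * 0 * D x + b2 * (1 - 0 * s) * \val x.
    by apply: UG => // y; have [_ _ _ ->] := H y; rewrite mul0r addr0.
  clearbody a1 a2 b1 b2 s.
  split.
    by split; apply: order_at_most_one_derivation dD _;
      [exact: f1E|exact: f2E|exact: g1E|exact: g2E].
  constructor 3.
  exists D, (a1 * p2%:R), (a1 * (1 - p2%:R * p1%:R * s)), (a2 * p1%:R),
    (a2 * (1 - p1%:R * p2%:R * s)), b1, b2.
  split; first exact: dD.
  split; first by split=> x; rewrite ?f1E ?f2E ?g1E ?g2E //; ring.
  split.
    have -> : p1%:R * (a1 * p2%:R) * b1 ^+ q1 + p2%:R * (a2 * p1%:R) * b2 ^+ q2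
      = p1%:R * p2%:R * (a1 * b1 ^+ q1 + a2 * b2 ^+ q2) by ring.
    by rewrite rel mulr0.
  split.
    have -> : a1 * (1 - p2%:R * p1%:R * s) * b1 ^+ q1 + a2 * (1 - p1%:R * p2%:R * s) * b2 ^+ q2
      = (1 - p1%:R * p2%:R * s) * (a1 * b1 ^+ q1 + a2 * b2 ^+ q2) by ring.
    by rewrite rel mulr0.
  (* Up to the factor x^(p2-p1), f1 (x^p1) / a1 and f2 (x^p2) / a2 are both p1 p2 x^(p1-1) D x + (1
     - p1 p2 s) x^p1. *)
  exists (a1 / a2) => x; rewrite f1E f2E !DX !rmorphXn /=.
  have -> : \val x ^+ p2.-1 = \val x ^+ (p2 - p1) * \val x ^+ p1.-1 :> R[i].
    by rewrite -exprD; congr (_ ^+ _); clear -p1_gt0 lt_p1_p2; lia.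
  have -> : \val x ^+ p2 = \val x ^+ (p2 - p1) * \val x ^+ p1 :> R[i].
    by rewrite -exprD; congr (_ ^+ _); clear -p1_gt0 lt_p1_p2; lia.
  by field.
Qed.
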